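(* Let $G$ be a finite simple graph with $n$ vertices and $m$ edges, without isolated vertices. Then $$s_Q(G)\ \ge\ \frac{4}{n}\sqrt{n\,M_1(G)-4m^2}.$$
   Context: For a finite simple graph $G$ on $n$ vertices with vertex degrees $d_1,\ldots,d_n$, let $A_G$ be its adjacency matrix and $D_G$ the diagonal matrix of vertex degrees. The signless Laplacian matrix is $Q_G=D_G+A_G$ with eigenvalues $q_1\ge q_2\ge\cdots\ge q_n$, and the signless Laplacian spread is $s_Q(G)=q_1-q_n$. The first Zagreb index is $M_1(G)=\sum_{i=1}^n d_i^2$. *)

(* Defs.v *)
From mathcomp Require Import all_boot all_order all_algebra.
From mathcomp Require Import polyrcf.

Set Implicit Arguments.
Unset Strict Implicit.
Unset Printing Implicit Defensive.

Import Order.TTheory GRing.Theory Num.Theory.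
Local Open Scope ring_scope.

Record sgraph (n : nat) := SGraph {
  adj : rel 'I_n;
  adj_sym : symmetric adj;
  adj_irr : irreflexive adj
}.

Section Graph.
Variables (n : nat) (G : sgraph n).

Definition edges : {set {set 'I_n}} :=
  [set [set p.1; p.2] | p : 'I_n * 'I_n & adj G p.1 p.2].

Definition deg (i : 'I_n) : nat := #|[set j | adj G i j]|.

Definition no_isolated_vertex : Prop := forall i, exists j, adj G i j.

Definition zagreb1 : nat := (\sum_(i < n) deg i ^ 2)%N.

End Graph.

(* The eigenvalues of A lying in R, listed in nonincreasing order and repeated
   according to their algebraic multiplicity; [rootsR] lists each root once.
   For a symmetric A over a real closed field the list has length n. *)
Definition eigenvalues (R : rcfType) n (A : 'M[R]_n) : seq R :=
  sort >=%R (flatten [seq nseq (mup x (char_poly A)) x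
                     | x <- rootsR (char_poly A)]).

Section SignlessLaplacian.
Variables (R : rcfType) (n : nat) (G : sgraph n).

Definition adjacency_mx : 'M[R]_n := \matrix_(i, j) (adj G i j)%:R.

Definition degree_mx : 'M[R]_n := diag_mx (\row_i (deg G i)%:R).

Definition signless_laplacian : 'M[R]_n := degree_mx + adjacency_mx.

(* q_1 and q_n are the entries of index 0 and n.-1. *)
Definition signless_spread : R :=
  let q := eigenvalues signless_laplacian in q`_0 - q`_n.-1.

End SignlessLaplacian.

(* Main.v *)
(* Let a and b be the least and the largest eigenvalue of the signless Laplacian
   Q, and u the all-ones vector. By the spectral theorem (b - Q)(Q - a) is
   positive semidefinite, and evaluating it at u, with u Q u^T = 4m,
   u Q^2 u^T = 4 M_1 and u u^T = n, gives 4(a + b)m - 4 M_1 - nab >= 0. This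
   yields the bound on b - a after completing a square. *)
Require Import Defs.
From mathcomp Require Import all_boot all_order all_algebra.
From mathcomp Require Import polyrcf complex spectral ring.

Set Implicit Arguments.
Unset Strict Implicit.
Unset Printing Implicit Defensive.

Import Order.TTheory GRing.Theory Num.Theory.
Local Open Scope ring_scope.

Lemma char_poly_conj (F : fieldType) n (P D : 'M[F]_n) :
  P \in unitmx -> char_poly (invmx P *m D *m P) = char_poly D.
Proof.
move=> Pu; rewrite /char_poly /char_poly_mx.
have PP : map_mx polyC (invmx P) *m map_mx polyC P = 1%:M :> 'M[{poly F}]_n.
  by rewrite -map_mxM mulVmx// map_mx1.
have -> : 'X%:M - map_mx polyC (invmx P *m D *m P) =
    map_mx polyC (invmx P) *m ('X%:M - map_mx polyC D) *m map_mx polyC P.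
  rewrite mulmxBr mulmxBl !map_mxM; congr (_ - _).
  by rewrite scalar_mxC -mulmxA PP mulmx1.
by rewrite 2!det_mulmx mulrAC -det_mulmx PP det1 mul1r.
Qed.

(** Under a total order, permuted lists have the same sorted form, so it suffices to compare counts:
    each [x] occurs [mup x (char_poly A)] times in both lists. *)
Lemma eigenvaluesE (R : rcfType) n (A : 'M[R]_n) (s : seq R) :
  char_poly A = \prod_(x <- s) ('X - x%:P) -> eigenvalues A = sort >=%R s.
Proof.
move=> cA; rewrite /eigenvalues; apply/perm_sortP.
- by move=> x y; exact: le_total.
- by move=> y x z /= yx zy; exact: le_trans zy yx.
- by move=> x y /= /andP[yx xy]; apply/le_anti/andP.
have p0 : char_poly A != 0 by rewrite monic_neq0// char_poly_monic.
apply/allP => x _ /=; apply/eqP.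
rewrite -[RHS]mu_prod_XsubC -cA count_flatten -map_comp sumnE big_map.
under eq_bigr do rewrite /= count_nseq /= eq_sym.
have rx := roots_on_rootsR p0 x; rewrite in_itv /= in rx.
have [xr|xNr] := boolP (x \in rootsR (char_poly A)).
  rewrite (bigD1_seq x)//= ?eqxx ?mul1n; last exact: uniq_roots.
  by rewrite big1 ?addn0// => y /negbTE; rewrite eq_sym => ->.
rewrite mupNroot ?rx// big_seq big1// => y yr; case: eqP => // xy.
by rewrite xy yr in xNr.
Qed.

(** Over [R[i]] the matrix becomes hermitian, so the complex spectral theorem applies and the
    diagonal is real. Its entries [d 0 i] are, up to order, the list [q], hence lie between the ends
    of that sorted list. *)
Lemma symmetric_spectral (R : rcfType) n (A : 'M[R]_n) : A^T = A ->
  exists2 P : 'M[R[i]]_n, P \is unitarymx & exists2 d : 'rV[R]_n,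
    map_mx (real_complex R) A =
      invmx P *m diag_mx (map_mx (real_complex R) d) *m P &
    let q := eigenvalues A in forall i, q`_n.-1 <= d 0 i <= q`_0.
Proof.
move=> symA; set A' := map_mx _ A.
have hA : A' \is hermsymmx.
  apply: realsym_hermsym.
    apply/is_hermitianmxP; rewrite expr0 scale1r map_mx_id//.
    by rewrite /A' map_trmx symA.
  by apply/mxOverP => i j; rewrite mxE; apply/complex_realP; exists (A i j).
have Pu := spectral_unitarymx A'; set P := spectralmx A' in Pu.
pose d := map_mx (@complex.Re R) (spectral_diag A').
have Ad : A' = invmx P *m diag_mx (map_mx (real_complex R) d) *m P.
  rewrite -map_mx_comp.
  have -> : map_mx (real_complex R \o @complex.Re R) (spectral_diag A') =
      spectral_diag A'.
    apply/matrixP => i j; rewrite mxE /= RRe_real//.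
    exact: (mxOverP (hermitian_spectral_diag_real hA)).
  exact/orthomx_spectralP/hermitian_normalmx.
exists P => //; exists d => // q i.
pose s := [seq d 0 i | i <- enum 'I_n].
have qE : q = sort >=%R s.
  (* The factorization over [R] may be checked after embedding in [R[i]], where the matrix is
     similar to a diagonal one. *)
  apply: eigenvaluesE; apply: (map_poly_inj (real_complex R)).
  rewrite map_char_poly -/A' Ad char_poly_conj ?unitarymx_unit//.
  rewrite char_poly_trig ?diag_mx_is_trig// rmorph_prod big_map big_enum /=.
  by apply: eq_bigr => k _; rewrite !mxE eqxx mulr1n map_polyXsubC.
have ge_trans : transitive (>=%R : rel R).
  by move=> y x z /= yx zy; exact: le_trans zy yx.
have qs : sorted >=%R q by rewrite qE sort_sorted// => x y; exact: le_total.
have qsz : size q = n by rewrite qE size_sort size_map size_enum_ord.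
have n_gt0 : (0 < n)%N by apply: leq_trans (ltn_ord i).
have : d 0 i \in q by rewrite qE mem_sort map_f// mem_enum.
case/(nthP 0) => k; rewrite qsz => kn <-.
have qmono := sorted_leq_nth ge_trans (@lexx _ R) 0 qs.
rewrite qsz in qmono.
by apply/andP; split; apply: qmono; rewrite ?inE ?prednK// -ltnS prednK.
Qed.

(** With [V] the coordinates of [u] in a unitary eigenbasis, the form equals the sum of
    [(q_1 - d_i) (d_i - q_n) |V_i|^2], whose terms are all nonnegative. Since [u] is real and [P]
    unitary, [P u^T] is the adjoint of [V]. *)
Lemma symmetric_quadratic_form_bound (R : rcfType) n (A : 'M[R]_n)
    (u : 'rV[R]_n) (q := eigenvalues A) : A^T = A ->
  0 <= (u *m ((q`_0)%:M - A) *m (A - (q`_n.-1)%:M) *m u^T) 0 0.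
Proof.
move=> symA; have [P Pu [d Ad d_bounds]] := symmetric_spectral symA.
set toC := real_complex R in Ad.
pose D := diag_mx (map_mx toC d); pose V := map_mx toC u *m invmx P.
have mapM c : map_mx toC c%:M = invmx P *m (toC c)%:M *m P.
  by rewrite map_scalar_mx scalar_mxC -mulmxA mulVmx ?unitarymx_unit// mulmx1.
have mapMB c : map_mx toC (c%:M - A) = invmx P *m ((toC c)%:M - D) *m P.
  by rewrite map_mxB mapM Ad mulmxBr mulmxBl.
have mapBM c : map_mx toC (A - c%:M) = invmx P *m (D - (toC c)%:M) *m P.
  by rewrite map_mxB mapM Ad mulmxBr mulmxBl.
have VtC : (V^t*)%sesqui = P *m map_mx toC u^T.
  rewrite /V invmx_unitary// trmx_mul map_mxM trmxCK; congr (_ *m _).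
  rewrite map_trmx realmxC//; apply/mxOverP => i j.
  by rewrite !mxE; apply/complex_realP; exists (u j i).
have expand :
    map_mx toC (u *m ((q`_0)%:M - A) *m (A - (q`_n.-1)%:M) *m u^T) =
    V *m ((toC q`_0)%:M - D) *m (D - (toC q`_n.-1)%:M) *m (V^t*)%sesqui.
  rewrite VtC 3!map_mxM mapMB mapBM.
  by rewrite !mulmxA mulmxK ?unitarymx_unit.
rewrite -ler0c.
have -> (M : 'M[R]_1) : ((M 0 0)%:C)%C = map_mx toC M 0 0 by rewrite mxE.
rewrite expand; clearbody V.
have -> : (toC q`_0)%:M - D = diag_mx (map_mx toC (\row_i (q`_0 - d 0 i))).
  by apply/matrixP => i j; rewrite !mxE /toC rmorphB mulrnBl.
have -> : D - (toC q`_n.-1)%:M =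
    diag_mx (map_mx toC (\row_i (d 0 i - q`_n.-1))).
  by apply/matrixP => i j; rewrite !mxE /toC rmorphB mulrnBl.
rewrite mxE sumr_ge0// => i _; rewrite !mul_mx_diag !mxE.
rewrite mulrAC (mulrAC (V 0 i)) -mulrA -normCK.
have /andP[? ?] := d_bounds i.
by rewrite mulr_ge0 ?exprn_ge0// -rmorphM ler0c mulr_ge0// subr_ge0.
Qed.

Lemma eigenvalues_head_ge_last (R : rcfType) n (A : 'M[R]_n)
    (q := eigenvalues A) : A^T = A -> q`_n.-1 <= q`_0.
Proof.
(* For [n = 0] both indices are 0 and the two sides coincide; otherwise any diagonal entry [d 0 i]
   separates them. *)
case: n => [|n] in A q *; first by move=> _; exact: lexx.
move=> /symmetric_spectral[_ _ [d _ /(_ ord0) /andP[]]]; exact: le_trans.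
Qed.

(** Both sides count ordered adjacent pairs: the fibre over an edge [{a, b}] is [(a, b)] and
    [(b, a)], distinct by irreflexivity. *)
Lemma handshake n (G : sgraph n) : (\sum_i deg G i = 2 * #|edges G|)%N.
Proof.
have -> : (\sum_i deg G i = \sum_(p : 'I_n * 'I_n | adj G p.1 p.2) 1)%N.
  transitivity (\sum_i \sum_(j | adj G i j) 1)%N; last by rewrite pair_big_dep.
  by apply: eq_bigr => i _; rewrite sum1dep_card.
rewrite (partition_big_imset (fun p => [set p.1; p.2])) /= mulnC -sum_nat_const.
apply: eq_big => [e|_ /imsetP[[a b] /= ab ->]].
  by apply/imsetP/imsetP => -[p pG ->]; exists p => //; move: pG; rewrite !inE.
rewrite sum1dep_card.
have ba : adj G b a by rewrite adj_sym.
have nab : a != b by apply: contraTneq ab => ->; rewrite [_ \in _](adj_irr G).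
suff -> : [set p | adj G p.1 p.2 & [set p.1; p.2] == [set a; b]] =
    [set (a, b); (b, a)] by rewrite cards2 xpair_eqE (negbTE nab).
apply/setP => -[c d]; rewrite !inE /= !xpair_eqE.
apply/andP/orP => [[cd /eqP /setP E]|[]/andP[/eqP-> /eqP->]]; last first.
- by split; rewrite // setUC.
- by split.
have ncd : c != d by apply: contraTneq cd => ->; rewrite adj_irr.
(* Of the four ways to place [c] and [d] in [{a, b}], the two with [c = d] contradict [ncd]. *)
have /set2P[] : c \in [set a; b] by rewrite -E set21.
all: have /set2P[] : d \in [set a; b] by rewrite -E set22.
all: by move=> ? ?; subst; rewrite ?eqxx in ncd *; auto.
Qed.

Section SignlessLaplacian.
Variables (R : rcfType) (n : nat) (G : sgraph n).
Local Notation Q := (signless_laplacian R G).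

Lemma signless_laplacian_sym : Q^T = Q.
Proof.
by apply/matrixP => i j; rewrite !mxE adj_sym eq_sym; case: eqP => // ->.
Qed.

Lemma signless_laplacian_row_sum :
  const_mx 1 *m Q = \row_j (2 * (deg G j)%:R) :> 'rV[R]_n.
Proof.
apply/rowP => j; rewrite mulmxDr !mxE mulr_natl mulr2n; congr (_ + _).
  rewrite (bigD1 j)//= !mxE eqxx mul1r big1 ?addr0// => i /negbTE ij.
  by rewrite !mxE ij mul1r.
under eq_bigr do rewrite !mxE mul1r adj_sym.
by rewrite -natr_sum -big_mkcond sum1dep_card.
Qed.

Lemma signless_eigenvalues_ineq (q := eigenvalues Q) (b := q`_0) (a := q`_n.-1) :
  0 <= 4 * (a + b) * #|edges G|%:R - 4 * (zagreb1 G)%:R - n%:R * a * b.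
Proof.
pose u := const_mx 1 : 'rV[R]_n.
have := symmetric_quadratic_form_bound u signless_laplacian_sym.
rewrite -/q -/a -/b => /le_trans; apply; rewrite le_eqVlt; apply/orP; left.
rewrite -mulmxA.
(* Symmetry of [Q] turns the form into the dot product of [b u - u Q] and [u Q - a u], whose entries
   are [b - 2 d_i] and [2 d_i - a] for [d_i] the degree of [i]. *)
have -> : (Q - a%:M) *m u^T = (u *m Q - a *: u)^T.
  rewrite mulmxBl linearB /= trmx_mul signless_laplacian_sym mul_scalar_mx.
  by congr (_ - _); apply/matrixP => i j; rewrite !mxE.
rewrite mulmxBr mul_mx_scalar signless_laplacian_row_sum mxE.
rewrite /zagreb1 natr_sum.
(* Each term is spread over the vertices, leaving the identity [(b - 2 d_i) (2 d_i - a) = 2 (a + b)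
   d_i - 4 d_i^2 - a b] at each vertex. *)
have -> : 4 * (a + b) * #|edges G|%:R =
    \sum_i 2 * (a + b) * (deg G i)%:R :> R.
  by rewrite -mulr_sumr -natr_sum handshake natrM; ring.
have -> : n%:R * a * b = \sum_(i < n) a * b.
  by rewrite sumr_const card_ord -mulrA mulr_natl.
rewrite mulr_sumr -!sumrB; apply/eqP/eq_bigr => i _.
by rewrite !mxE natrX; ring.
Qed.

End SignlessLaplacian.

Theorem corollary24 (R : rcfType) (n m : nat) (G : sgraph n)
    (hm : #|edges G| = m) (hiso : no_isolated_vertex G) :
  signless_spread R G >=
    4 / n%:R * Num.sqrt (n%:R * (zagreb1 G)%:R - 4 * m%:R ^+ 2).
Proof.
have := signless_eigenvalues_ineq R G.
have := eigenvalues_head_ge_last (signless_laplacian_sym R G).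
rewrite /signless_spread hm; set b := _`_0; set a := _`_n.-1 => ab ineq.
(* For [n = 0], division by zero yields 0, so the bound reads [0 <= b - a]. *)
have [n0|n_gt0] := posnP n.
  by rewrite [X in 4 / X%:R]n0 invr0 mulr0 mul0r subr_ge0.
have n_pos : 0 < n%:R :> R by rewrite ltr0n.
(* Cancelling the factor [4 / n] leaves [t] against the square root; as [t >= 0], it is enough to
   compare [t^2] with the radicand. *)
pose t := n%:R * (b - a) / 4.
have -> : b - a = 4 / n%:R * t by rewrite /t; field; rewrite gt_eqF.
rewrite ler_wpM2l ?divr_ge0 ?ler0n//.
have t_ge0 : 0 <= t by rewrite divr_ge0// mulr_ge0// ?ler0n// subr_ge0.
rewrite -[leRHS](ger0_norm t_ge0) -sqrtr_sqr ler_wsqrtr// -subr_ge0.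
set N := n%:R in n_pos ineq t t_ge0 *; set M := m%:R in ineq *.
set Z := (zagreb1 G)%:R in ineq *.
(* Writing [(b - a)^2 = (a + b)^2 - 4 a b] in [t^2] and splitting off [N / 4] times the expression
   in [ineq] leaves a perfect square. *)
have -> : t ^+ 2 - (N * Z - 4 * M ^+ 2) =
    N / 4 * (4 * (a + b) * M - 4 * Z - N * a * b) +
    (N * (a + b) / 4 - 2 * M) ^+ 2 by rewrite /t; field.
by rewrite addr_ge0 ?sqr_ge0// mulr_ge0// divr_ge0// ltW.
Qed.
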